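(* Let $W=[w_{mn}]\in\mathbb{R}^{N\times N}$ ($N\ge3$) be the transition matrix of a continuous-time Markov jump process satisfying the assumptions of the context, with steady state $\pi$, let $\tau>0$, and let $a,b\in\mathbb{R}^N$ be observables with $D_a^\tau D_b^\tau\neq0$. Let $\mathcal{K}$ be the set of cycles of a uniform cycle decomposition of the finite-time currents $J_{mn}$. Then $$\frac{|\delta C_{ba}^\tau|}{2\sqrt{D_a^\tau D_b^\tau}}\le\max_{c\in\mathcal{K}}\frac{\tanh\!\big(\mathcal{F}_c^\tau/(2|c|)\big)}{\tan(\pi/|c|)}\le\max_{c\in\mathcal{K}}\frac{\mathcal{F}_c^\tau}{2\pi}.$$
   Context: Setting. $w_{mn}\ge0$ for $m\neq n$ is the jump rate from state $n$ to state $m$, $w_{nn}=-\sum_{m\neq n}w_{mn}$, and $\dot p_t=Wp_t$. Local detailed balance is assumed: $w_{mn}>0$ if and only if $w_{nm}>0$ for $m\ne n$. The eigenvalue $0$ of $W$ is simple and all other eigenvalues have negative real part. $\pi$ is the steady state: a probability vector with $W\pi=0$. $\Pi:=\mathrm{diag}(\pi_1,\dots,\pi_N)$. Correlations: $C_{ba}^\tau:=b^\top e^{W\tau}\Pi a$, $\delta C_{ba}^\tau:=C_{ba}^\tau-C_{ab}^\tau$, and $D_a^\tau:=C_{aa}^0-C_{aa}^\tau$ (similarly $D_b^\tau$). Coarse-grained affinity: $w_{mn}^\tau:=[e^{W\tau}]_{mn}$ is the conditional probability of going from $n$ to $m$ in time $\tau$, and for a cycle $c=(n_1,\dots,n_{|c|})$,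 $$\mathcal{F}_c^\tau:=\ln\frac{w_{n_2n_1}^\tau w_{n_3n_2}^\tau\cdots w_{n_1n_{|c|}}^\tau}{w_{n_1n_2}^\tau w_{n_2n_3}^\tau\cdots w_{n_{|c|}n_1}^\tau}.$$ Cycles: let $J_{mn}:=w_{mn}^\tau\pi_n-w_{nm}^\tau\pi_m$, which satisfies $\sum_mJ_{mn}=0$ for all $n$. A cycle $c=(n_1,\dots,n_{|c|})$ is a directed cycle of $|c|\ge3$ distinct states with edges $n_i\to n_{i+1}$ (index $|c|+1\equiv1$). A uniform cycle decomposition is a finite set $\mathcal{K}$ of cycles with positive weights $J^c$ such that every edge $n\to m$ of every $c\in\mathcal{K}$ has $J_{mn}>0$, and for each directed edge $e=(n\to m)$ with $J_{mn}>0$ one has $J_{mn}=\sum_{c\in\mathcal{K}:\,e\in c}J^c$. If all $J_{mn}=0$, then $\mathcal{K}$ is empty and the maxima are read as $0$. *)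

(* Defs.v *)
From HB Require Import structures.
From mathcomp Require Import all_boot all_order all_algebra.
From mathcomp Require Import all_classical all_reals all_analysis.
From mathcomp Require Import complex.
Set Implicit Arguments.
Unset Strict Implicit.
Unset Printing Implicit Defensive.
Import Order.TTheory GRing.Theory Num.Theory.
Import numFieldNormedType.Exports.
Local Open Scope ring_scope.

Definition tanh (R : realType) (x : R) : R :=
  (expR x - expR (- x)) / (expR x + expR (- x)).

Definition expm (R : realType) (N : nat) (A : 'M[R]_N) : 'M[R]_N :=
  limn (series (fun k : nat => k`!%:R^-1 *: A ^+ k)).

(* [W m n] is the rate of the jump from n to m, so that columns sum to 0.
   "Simple" is algebraic multiplicity one; the rest of the spectrum is that
   of W viewed as a complex matrix. *)
Record jump_process (R : realType) (N : nat) (W : 'M[R]_N) : Prop := {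
  jp_rate_ge0 : forall m n : 'I_N, m != n -> 0 <= W m n;
  jp_diag : forall n : 'I_N, W n n = - \sum_(m | m != n) W m n;
  jp_detailed_balance : forall m n : 'I_N,
    m != n -> (0 < W m n <-> 0 < W n m);
  jp_eigen0_simple : mup 0 (char_poly W) = 1%N;
  jp_eigen_neg : forall z : R[i],
    eigenvalue (map_mx (real_complex R) W) z -> z != 0 -> complex.Re z < 0
}.

Record steady_state (R : realType) (N : nat) (W : 'M[R]_N) (p : 'cV[R]_N)
  : Prop := {
  ss_ge0 : forall n : 'I_N, 0 <= p n 0;
  ss_sum1 : \sum_n p n 0 = 1;
  ss_stationary : W *m p = 0
}.

(* Conditional probability of going from n to m in time tau. *)
Definition trans_prob (R : realType) (N : nat) (W : 'M[R]_N) (tau : R)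
  (m n : 'I_N) : R := expm (tau *: W) m n.

(* [corr W p b a tau] is C_{ba}^tau. *)
Definition corr (R : realType) (N : nat) (W : 'M[R]_N) (p b a : 'cV[R]_N)
  (tau : R) : R :=
  (b^T *m expm (tau *: W) *m diag_mx p^T *m a) 0 0.

Definition corr_asym (R : realType) (N : nat) (W : 'M[R]_N)
  (p b a : 'cV[R]_N) (tau : R) : R := corr W p b a tau - corr W p a b tau.

Definition corr_decay (R : realType) (N : nat) (W : 'M[R]_N)
  (p a : 'cV[R]_N) (tau : R) : R := corr W p a a 0 - corr W p a a tau.

(* Net finite-time current J_{mn} from n to m. *)
Definition current (R : realType) (N : nat) (W : 'M[R]_N) (p : 'cV[R]_N)
  (tau : R) (m n : 'I_N) : R :=
  trans_prob W tau m n * p n 0 - trans_prob W tau n m * p m 0.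

Definition is_cycle (N : nat) (c : seq 'I_N) : bool :=
  uniq c && (3 <= size c)%N.

(* n -> m is an edge of the directed cycle c; [next] wraps around. *)
Definition cycle_edge (N : nat) (c : seq 'I_N) (n m : 'I_N) : bool :=
  (n \in c) && (m == next c n).

Definition affinity (R : realType) (N : nat) (W : 'M[R]_N) (tau : R)
  (c : seq 'I_N) : R :=
  ln ((\prod_(n <- c) trans_prob W tau (next c n) n) /
      (\prod_(n <- c) trans_prob W tau n (next c n))).

Record uniform_cycle_decomposition (R : realType) (N : nat)
  (J : 'I_N -> 'I_N -> R) (K : seq (seq 'I_N)) (Jc : seq 'I_N -> R)
  : Prop := {
  ucd_uniq : uniq K;
  ucd_cycle : forall c, c \in K -> is_cycle c;
  ucd_weight_gt0 : forall c, c \in K -> 0 < Jc c;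
  ucd_uniform : forall c, c \in K ->
    forall n m : 'I_N, cycle_edge c n m -> 0 < J m n;
  ucd_sum : forall n m : 'I_N, 0 < J m n ->
    J m n = \sum_(c <- K | cycle_edge c n m) Jc c
}.

(* Maximum of f over the list K, equal to 0 only by convention when K is
   empty: the default value of the iterated max is attained at the head. *)
Definition max_over (R : realType) (T : Type) (K : seq T) (f : T -> R) : R :=
  if K is c0 :: K' then \big[Num.max/f c0]_(c <- K') f c else 0.

(* Main.v *)
Require Import Defs.
From HB Require Import structures.
From mathcomp Require Import all_boot all_order all_algebra.
From mathcomp Require Import all_classical all_reals all_analysis.
From mathcomp Require Import ring lra zify.
Import Order.TTheory GRing.Theory Num.Theory.
Import numFieldNormedType.Exports.
Local Open Scope classical_set_scope.
Local Open Scope ring_scope.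

(** Write [F_mn = w_mn^tau pi_n]. The cycle decomposition writes the asymmetry
    as a [J^c]-weighted sum over cycles of twice the signed area of the polygon
    with vertices [(a_n, b_n)], while [D_a + D_b] is at least half the same
    weighted sum of [coth (F_e / 2) |e|^2] over the edges [e] of the polygons,
    where [F_e = ln (F_mn / F_nm)]. The two are compared by the polygon inequality
    [2 * sum z_i x z_(i+1) <= sum cot(f_i) |z_(i+1) - z_i|^2], valid whenever
    [f_i > 0] and [sum f_i <= pi]; it follows from an identity that telescopes
    once [z_0] is moved to the origin. Taking
    [f_i = atan (C * tanh (F_i / 2))] with
    [C = tan (pi / n) / tanh (sum F_i / (2 n))], concavity of [atan] and [tanh]
    gives [sum f_i <= pi]. The affinities are finite because [exp (W tau)] has a
    symmetric support: it equals [e^-x exp (W tau + x)], a series with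
    nonnegative entries for large [x]. *)

(** * Cotangent-weighted isoperimetric inequality *)

Definition cot {R : realType} (x : R) : R := cos x / sin x.

(** With [x = cot P] and [y = cot f], the addition formula reads
    [cot (P + f) = (x * y - 1) / (x + y)]; the right side minus the left is then a sum of two
    squares over [x + y > 0]. *)
Lemma cot_edge_le {R : realType} (P f a b a' b' : R) :
  0 < P -> 0 < f -> P + f < pi ->
  cot (P + f) * (a' ^+ 2 + b' ^+ 2) - cot P * (a ^+ 2 + b ^+ 2) <=
  cot f * ((a' - a) ^+ 2 + (b' - b) ^+ 2) - 2 * (a * b' - a' * b).
Proof.
move=> P0 f0 Pf.
have sP : 0 < sin P by apply: sin_gt0_pi; rewrite P0 /=; lra.
have sf : 0 < sin f by apply: sin_gt0_pi; rewrite f0 /=; lra.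
have sPf : 0 < sin (P + f) by apply: sin_gt0_pi; rewrite Pf andbT; lra.
pose x := cot P; pose y := cot f.
have xyE : x + y = sin (P + f) / (sin P * sin f).
  by rewrite /x /y /cot sinD; field; rewrite !gt_eqF.
have xy0 : 0 < x + y by rewrite xyE divr_gt0 // mulr_gt0.
have cE : cot (P + f) = (x * y - 1) / (x + y).
  rewrite xyE /cot cosD /x /y /cot; field.
  by rewrite !gt_eqF.
rewrite cE -/x -/y -subr_ge0.
set e := (X in 0 <= X).
suff -> : e = (((x + y) * a - (y * a' + b')) ^+ 2 +
               ((x + y) * b - (y * b' - a')) ^+ 2) / (x + y).
  by apply: divr_ge0; [rewrite addr_ge0 // sqr_ge0 | exact: ltW].
by rewrite /e; field; rewrite gt_eqF.
Qed.

(** Induction on [n]: [cot_edge_le], with [P] the sum of the angles so far, telescopes. Starting at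
    the origin makes the first edge an equality. *)
Lemma cot_path_le {R : realType} (f a b : nat -> R) (n : nat) :
  (forall i, (i <= n)%N -> 0 < f i) ->
  \sum_(0 <= i < n.+1) f i < pi -> a 0 = 0 -> b 0 = 0 ->
  cot (\sum_(0 <= i < n.+1) f i) * (a n.+1 ^+ 2 + b n.+1 ^+ 2) <=
  \sum_(0 <= i < n.+1) (cot (f i) * ((a i.+1 - a i) ^+ 2 + (b i.+1 - b i) ^+ 2)
     - 2 * (a i * b i.+1 - a i.+1 * b i)).
Proof.
move=> f0 fpi a0 b0; elim: n => [|n IH] in f0 fpi *.
  by rewrite !big_nat1 a0 b0; rewrite le_eqVlt; apply/orP; left; apply/eqP; ring.
rewrite (big_nat_recr n.+1) //= in fpi *.
rewrite [leRHS](big_nat_recr n.+1) //=.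
have fn := f0 n.+1 (leqnn _).
have S0 : 0 < \sum_(0 <= i < n.+1) f i.
  rewrite big_nat_recr //= ltr_wpDl ?f0 // big_nat sumr_ge0 // => i /andP[_ lin].
  by rewrite ltW // f0 // ltnW // ltnW.
have := IH (fun i li => f0 i (leqW li)).
have := @cot_edge_le R _ _ (a n.+1) (b n.+1) (a n.+2) (b n.+2) S0 fn fpi.
move=> h h2.
have {}h2 := h2 ltac:(lra).
lra.
Qed.

Lemma polygon_cot_le {R : realType} (f a b : nat -> R) (n : nat) :
  (1 < n)%N ->
  (forall i, (i < n)%N -> 0 < f i) ->
  \sum_(0 <= i < n) f i <= pi -> a n = a 0 -> b n = b 0 ->
  2 * \sum_(0 <= i < n) (a i * b i.+1 - a i.+1 * b i) <=
  \sum_(0 <= i < n) cot (f i) * ((a i.+1 - a i) ^+ 2 + (b i.+1 - b i) ^+ 2).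
Proof.
case: n => [//|[//|n]] _ f0 fpi an bn.
pose a' i := a i - a 0; pose b' i := b i - b 0.
(* The signed area of a closed polygon is translation invariant: the difference is a combination of
   the sums of the increments of [a] and of [b], which telescope to 0. *)
have -> : \sum_(0 <= i < n.+2) (a i * b i.+1 - a i.+1 * b i) =
          \sum_(0 <= i < n.+2) (a' i * b' i.+1 - a' i.+1 * b' i).
  apply/eqP; rewrite -subr_eq0 -sumrB.
  rewrite (eq_bigr (fun i => a 0 * (b i.+1 - b i) - b 0 * (a i.+1 - a i))).
    by rewrite sumrB -!mulr_sumr !telescope_sumr // an bn !subrr !mulr0 subrr.
  by move=> i _; rewrite /a' /b'; ring.
have -> : \sum_(0 <= i < n.+2) cot (f i) * ((a i.+1 - a i) ^+ 2 + (b i.+1 - b i) ^+ 2) =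
   \sum_(0 <= i < n.+2) cot (f i) * ((a' i.+1 - a' i) ^+ 2 + (b' i.+1 - b' i) ^+ 2).
  by apply: eq_bigr => i _; rewrite /a' /b'; ring.
rewrite mulr_sumr -subr_ge0 -sumrB big_nat_recr //=.
rewrite (big_nat_recr n.+1) //= in fpi.
have a'0 : a' 0 = 0 by rewrite /a' subrr.
have b'0 : b' 0 = 0 by rewrite /b' subrr.
have a'n : a' n.+2 = 0 by rewrite /a' an subrr.
have b'n : b' n.+2 = 0 by rewrite /b' bn subrr.
have fn := f0 n.+1 (leqnn _).
have lt_pi : \sum_(0 <= i < n.+1) f i < pi by lra.
have f0' i : (i <= n)%N -> 0 < f i by move=> li; apply: f0; rewrite ltnS leqW.
have := @cot_path_le R f a' b' n f0' lt_pi a'0 b'0.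
have S0 : 0 < \sum_(0 <= i < n.+1) f i.
  rewrite big_nat_recr //= ltr_wpDl ?f0 // big_nat sumr_ge0 // => i /andP[_ lin].
  by rewrite ltW // f0' // ltnW.
move: (\sum_(0 <= i < n.+1) f i) => P in fpi lt_pi S0 *.
rewrite a'n b'n !sub0r !sqrrN !mul0r mulr0 subrr mulr0 subr0 => h.
have sP : 0 < sin P by apply: sin_gt0_pi; rewrite S0 /=; lra.
have sf : 0 < sin (f n.+1) by apply: sin_gt0_pi; rewrite fn /=; lra.
have sPf : 0 <= sin (P + f n.+1) by apply: sin_ge0_pi; rewrite fpi andbT; lra.
(* The closing edge returns to the origin, so its cross product vanishes and what remains is
   [cot P + cot (f n.+1)] times a squared length; its sign comes from [P + f n.+1 <= pi]. *)
have cc : 0 <= cot P + cot (f n.+1).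
  suff -> : cot P + cot (f n.+1) = sin (P + f n.+1) / (sin P * sin (f n.+1)).
    by apply: divr_ge0 => //; rewrite mulr_ge0 // ltW.
  by rewrite /cot sinD; field; rewrite !gt_eqF.
have := mulr_ge0 cc (addr_ge0 (sqr_ge0 (a' n.+1)) (sqr_ge0 (b' n.+1))).
by move=> h2; lra.
Qed.

(** * Tangent-line bounds for [atan], [tanh] and [tan] *)

(** Mean value theorem on either side of [y]: as [df] is nonincreasing on the nonnegative reals, the
    graph stays below its tangents there. *)
Lemma concave_tangent_le {R : realType} (f df : R -> R) :
  (forall x, is_derive x (1 : R) f (df x)) ->
  (forall x y, 0 <= x -> x <= y -> df y <= df x) ->
  forall x y, 0 <= x -> 0 <= y -> f x <= f y + df y * (x - y).
Proof.
move=> fdf dfanti x y x0 y0.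
have cf u v : {within `[u, v], continuous f}.
  by apply: derivable_within_continuous => z _; exact: ex_derive.
have [xy|yx] := leP x y.
  have [c] := MVT_segment xy (fun z _ => fdf z) (cf x y).
  rewrite in_itv /= => /andP[xc cy] E.
  have : df y * (y - x) <= df c * (y - x).
    by apply: ler_wpM2r; rewrite ?subr_ge0 // dfanti // (le_trans x0).
  lra.
have [c] := MVT_segment (ltW yx) (fun z _ => fdf z) (cf y x).
rewrite in_itv /= => /andP[yc cx] E.
have : df c * (x - y) <= df y * (x - y).
  by apply: ler_wpM2r; rewrite ?subr_ge0 ?dfanti // ltW.
lra.
Qed.

Lemma atan_tangent_le {R : realType} (x y : R) : 0 <= x -> 0 <= y ->
  atan x <= atan y + (1 + y ^+ 2)^-1 * (x - y).
Proof.
apply: (@concave_tangent_le R atan (fun z => (1 + z ^+ 2)^-1)) => {}x {}y x0 xy.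
rewrite lef_pV2 ?posrE ?ltr_pwDl ?sqr_ge0 // lerD2l lerXn2r ?nnegrE //.
exact: le_trans xy.
Qed.

Lemma tanhE {R : realType} (x : R) :
  tanh x = (expR (2 * x) - 1) / (expR (2 * x) + 1).
Proof.
rewrite /tanh expRN (_ : 2 * x = x + x); last by ring.
rewrite expRD; field.
have h := expR_gt0 x.
by rewrite !gt_eqF //= ?addr_gt0 ?mulr_gt0 ?expR_gt0 ?ltr01.
Qed.

Lemma tanh_exp_half {R : realType} (x : R) :
  tanh (x / 2) = (expR x - 1) / (expR x + 1).
Proof. by rewrite tanhE (_ : 2 * (x / 2) = x) //; field. Qed.

Lemma tanhE1 {R : realType} (x : R) : tanh x = 1 - 2 * (expR (2 * x) + 1)^-1.
Proof. by rewrite tanhE; field; rewrite gt_eqF // addr_gt0 // expR_gt0. Qed.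

Lemma tanh_ge0 {R : realType} (x : R) : 0 <= x -> 0 <= tanh x.
Proof.
move=> x0; rewrite tanhE; apply: divr_ge0; last by rewrite addr_ge0 ?expR_ge0.
by rewrite subr_ge0 -expR0 ler_expR mulr_ge0.
Qed.

Lemma tanh_gt0 {R : realType} (x : R) : 0 < x -> 0 < tanh x.
Proof.
move=> x0; rewrite tanhE; apply: divr_gt0; last by rewrite addr_gt0 ?expR_gt0.
by rewrite subr_gt0 -expR0 ltr_expR mulr_gt0.
Qed.

Lemma le_tanh {R : realType} : {homo @tanh R : x y / x <= y}.
Proof.
move=> x y xy; rewrite !tanhE1 lerD2l lerN2 ler_pM2l //.
rewrite lef_pV2 ?posrE ?addr_gt0 ?expR_gt0 //.
by rewrite lerD2r ler_expR ler_pM2l.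
Qed.

Lemma is_derive_tanh {R : realType} (x : R) :
  is_derive x (1 : R) (@tanh R) (1 - tanh x ^+ 2).
Proof.
have -> : @tanh R = (fun x => 1 - 2 * (expR (2 * x) + 1)^-1).
  by apply/funext => z; exact: tanhE1.
have h : expR (2 * x) + 1 != 0 by rewrite gt_eqF // addr_gt0 // expR_gt0.
by apply: is_derive_eq; rewrite -![_ *: _]/(_ * _); field.
Qed.

Lemma tanh_tangent_le {R : realType} (x y : R) : 0 <= x -> 0 <= y ->
  tanh x <= tanh y + (1 - tanh y ^+ 2) * (x - y).
Proof.
have H := @concave_tangent_le R (@tanh R) _ is_derive_tanh.
move=> x0 y0; apply: H => // {x y x0 y0} x y x0 xy.
have y0 := le_trans x0 xy.
by rewrite lerD2l lerN2 lerXn2r ?nnegrE ?tanh_ge0 // le_tanh.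
Qed.

Lemma tanh_le_id {R : realType} (x : R) : 0 <= x -> tanh x <= x.
Proof.
move=> x0; have := @tanh_tangent_le R x 0 x0 (lexx _).
by rewrite (tanhE 0) mulr0 expR0; lra.
Qed.

(** The tangent of [atan] at 0 gives [atan t <= t]; take [t = tan x]. *)
Lemma le_tan {R : realType} (x : R) : 0 <= x < pi / 2 -> x <= tan x.
Proof.
move=> /andP[x0 xpi].
have xI : x \in `](- (pi / 2)), (pi / 2)[ 
  by rewrite in_itv /= xpi andbT; have := pi_gt0 R; lra.
have t0 : 0 <= tan x.
  move: x0; rewrite le_eqVlt => /predU1P[<-|x0]; first by rewrite tan0.
  by rewrite /tan ltW // divr_gt0 ?sin_gt0_pihalf ?cos_gt0_pihalf ?x0 //;
    move: xI; rewrite in_itv.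
have := @atan_tangent_le R (tan x) 0 t0 (lexx _).
by rewrite tanK // atan0 expr0n /= addr0 invr1; lra.
Qed.

(** * Matrix exponentials *)

Lemma cvg_mx {R : realType} (m n : nat) (F : nat -> 'M[R]_(m, n)) (M : 'M[R]_(m, n)) :
  (forall i j, F k i j @[k --> \oo] --> M i j) -> F @ \oo --> M.
Proof.
move=> h; apply/cvg_mx_entourageP => A entA.
apply: filter_forall => i; apply: filter_forall => j.
have /cvg_entourageP/(_ A entA) := h i j.
by rewrite !near_map; apply: filterS => k; rewrite inE.
Qed.

(** One entry of the exponential series, so that results on scalar series apply. *)
Definition expm_coeff {R : realType} {N : nat} (A : 'M[R]_N) (i j : 'I_N) : R^nat :=
  fun k => k`!%:R^-1 * (A ^+ k) i j.

Definition mx_sumnorm {R : realType} {N : nat} (A : 'M[R]_N) : R :=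
  \sum_i \sum_j `|A i j|.

Lemma exprmx_le {R : realType} {N : nat} (A : 'M[R]_N) k i j :
  `|(A ^+ k) i j| <= mx_sumnorm A ^+ k.
Proof.
have S0 : 0 <= mx_sumnorm A by apply: sumr_ge0 => x _; apply: sumr_ge0.
elim: k i j => [|k IH] i j.
  by rewrite !expr0 mxE; case: eqP => _; rewrite ?normr1 ?normr0.
rewrite exprS -[A * _]/(A *m _) mxE (le_trans (ler_norm_sum _ _ _)) //.
apply: (@le_trans _ _ (\sum_l `|A i l| * mx_sumnorm A ^+ k)).
  by apply: ler_sum => l _; rewrite normrM ler_wpM2l.
rewrite -mulr_suml exprS ler_wpM2r ?exprn_ge0 //.
by rewrite /mx_sumnorm [leRHS](bigD1 i) //= lerDl sumr_ge0 // => x _; apply: sumr_ge0.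
Qed.

Lemma is_cvg_normed_expm {R : realType} {N : nat} (A : 'M[R]_N) i j :
  cvgn [normed series (expm_coeff A i j)].
Proof.
apply: (@series_le_cvg R _ (exp_coeff (mx_sumnorm A))) => [n|n|n|].
- exact: normr_ge0.
- by rewrite exp_coeff_ge0 // sumr_ge0 // => x _; apply: sumr_ge0.
- rewrite /expm_coeff /exp_coeff /= normrM mulrC.
  rewrite (ger0_norm (_ : 0 <= n`!%:R^-1)) ?invr_ge0 //.
  by rewrite ler_wpM2r ?invr_ge0 // exprmx_le.
- exact: is_cvg_series_exp_coeff.
Qed.

Lemma is_cvg_expm {R : realType} {N : nat} (A : 'M[R]_N) i j :
  cvgn (series (expm_coeff A i j)).
Proof. by apply: normed_cvg; exact: is_cvg_normed_expm. Qed.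

Lemma expmE {R : realType} {N : nat} (A : 'M[R]_N) i j :
  expm A i j = limn (series (expm_coeff A i j)).
Proof.
pose L : 'M[R]_N := \matrix_(i, j) limn (series (expm_coeff A i j)).
suff -> : expm A = L by rewrite mxE.
apply/cvg_lim => //; apply: cvg_mx => {}i {}j; rewrite mxE.
rewrite (_ : (fun k => _) = series (expm_coeff A i j)); first exact: is_cvg_expm.
apply/funext => k; rewrite /series /= summxE; apply: eq_bigr => l _.
by rewrite mxE.
Qed.

Lemma cvg_expm {R : realType} {N : nat} (A : 'M[R]_N) i j :
  series (expm_coeff A i j) @ \oo --> expm A i j.
Proof. by rewrite expmE; exact: is_cvg_expm. Qed.

(** * Cauchy products and shifts of the exponential *)

(** Both sides sum over the triangle [i + j < M], by diagonals and by rows. *)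
Lemma series_convE {R : realType} (u v : R^nat) M :
  \sum_(0 <= n < M) \sum_(0 <= i < n.+1) u i * v (n - i)%N =
  \sum_(0 <= i < M) \sum_(0 <= j < M - i) u i * v j.
Proof.
elim: M => [|M IH]; first by rewrite !big_geq.
rewrite big_nat_recr //= IH [RHS]big_nat_recr //= subSnn big_nat1.
rewrite [X in _ + X]big_nat_recr //= subnn addrA -big_split /=; congr (_ + _).
apply: eq_big_nat => i /andP[_ iM].
by rewrite subSn ?big_nat_recr // ltnW.
Qed.

(** Square and triangular partial sums differ by a remainder that is bounded by the same remainder
    for the absolute values, which tends to 0. *)
Lemma cvg_cauchy_product {R : realType} (u v : R^nat) :
  cvgn [normed series u] -> cvgn [normed series v] ->
  series (fun n => \sum_(0 <= i < n.+1) u i * v (n - i)%N) @ \oo -->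
  limn (series u) * limn (series v).
Proof.
move=> cu cv.
(* [P] sums over the square [i, j < M], [C] over the triangle [i + j < M]. *)
pose P (u v : R^nat) M := series u M * series v M.
pose C (u v : R^nat) M := \sum_(0 <= i < M) \sum_(0 <= j < M - i) u i * v j.
pose u' n := `|u n|; pose v' n := `|v n|.
have u0 i : 0 <= u' i by exact: normr_ge0.
have v0 i : 0 <= v' i by exact: normr_ge0.
have PE x y M : P x y M = \sum_(0 <= i < M) \sum_(0 <= j < M) x i * y j.
  by rewrite /P /series /= mulr_suml; apply: eq_bigr => i _; rewrite mulr_sumr.
have PCE x y M : P x y M - C x y M =
    \sum_(0 <= i < M) \sum_(M - i <= j < M) x i * y j.
  rewrite PE -sumrB; apply: eq_bigr => i _.
  by rewrite (@big_cat_nat _ _ _ (M - i)) ?leq_subr //= addrAC subrr add0r.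
have CP M : `|P u v M - C u v M| <= P u' v' M - C u' v' M.
  rewrite !PCE (le_trans (ler_norm_sum _ _ _)) // ler_sum // => i _.
  by rewrite (le_trans (ler_norm_sum _ _ _)) // ler_sum // => j _; rewrite normrM.
(* The square of side [M./2] lies inside the triangle. *)
have PC M : P u' v' M./2 <= C u' v' M.
  rewrite PE /C.
  have hM : (M./2 <= M)%N by lia.
  rewrite [leRHS](@big_cat_nat _ _ _ M./2) //= -[leLHS]addr0 lerD //.
    rewrite big_nat [leRHS]big_nat ler_sum // => i /andP[_ iM].
    have hMi : (M./2 <= M - i)%N.
      lia.
    rewrite [leRHS](@big_cat_nat _ _ _ M./2) //= lerDl.
    by rewrite sumr_ge0 // => j _; rewrite mulr_ge0.
  by rewrite sumr_ge0 // => i _; rewrite sumr_ge0 // => j _; rewrite mulr_ge0.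
have cP : P u v @ \oo --> limn (series u) * limn (series v).
  by apply: cvgM; [exact: normed_cvg cu|exact: normed_cvg cv].
have cP' : P u' v' @ \oo --> limn (series u') * limn (series v').
  exact: cvgM cu cv.
have cP2 : P u' v' (M./2) @[M --> \oo] --> limn (series u') * limn (series v').
  apply: cvg_comp cP'.
  move=> A [k _ kA]; exists k.*2 => // n /= kn; apply: kA => /=.
  by rewrite -[k]doubleK half_leq.
have c0 : P u v M - C u v M @[M --> \oo] --> 0.
  apply/norm_cvg0P.
  apply: (@squeeze_cvgr _ _ _ _ (fun=> 0) (fun M => P u' v' M - P u' v' M./2)).
  - apply: nearW => M; rewrite normr_ge0 /= (le_trans (CP M)) // lerD2l lerN2.
    exact: PC.
  - exact: cvg_cst.
  - by rewrite -(subrr (limn (series u') * limn (series v'))); apply: cvgB.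
rewrite (_ : series _ = (fun M => P u v M - (P u v M - C u v M))).
  by rewrite -[X in _ --> X]subr0; apply: cvgB.
by apply/funext => M; rewrite subKr /series /= series_convE.
Qed.

Lemma mx_scalar_expr {R : realType} {N : nat} (x : R) k :
  (x%:M : 'M[R]_N) ^+ k = (x ^+ k)%:M.
Proof.
elim: k => [|k IH]; first by rewrite !expr0.
by rewrite exprS IH -[_ * _]/(_ *m _) -scalar_mxM -exprS.
Qed.

(** The scalar matrix commutes with [A], so the binomial formula identifies the Cauchy product of
    the two series with the series of the sum. *)
Lemma expm_shift {R : realType} {N : nat} (A : 'M[R]_N) (x : R) i j :
  expm (A + x%:M) i j = expR x * expm A i j.
Proof.
rewrite !expmE.
have cx : cvgn [normed series (exp_coeff x)].
  by rewrite normed_series_exp_coeff; exact: is_cvg_series_exp_coeff.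
have := cvg_cauchy_product _ _ cx (is_cvg_normed_expm A i j).
move=> /cvg_lim <- //; congr (limn (series _)).
apply/funext => n; rewrite /expm_coeff exprDn_comm; last first.
  exact: (scalar_mxC x A).
rewrite big_mkord summxE mulr_sumr; apply: eq_bigr => -[k /= kn] _.
rewrite mx_scalar_expr -[_ * _%:M]/(_ *m _) mul_mx_scalar mulmxnE mxE.
rewrite -mulr_natr /exp_coeff /= ltnS in kn *.
rewrite -(bin_fact kn) !natrM.
have := fact_gt0 k; have := fact_gt0 (n - k); have := bin_gt0 n k.
rewrite kn -!(ltr0n R) => h1 h2 h3; field.
by rewrite !gt_eqF.
Qed.

(** The powers [A ^+ k] with [k > 0] annihilate [x], so only the term of index 0 survives.
    Conservation of probability and stationarity both follow from this. *)
Lemma expm_mul_ker {R : realType} {N m : nat} (A : 'M[R]_N) (x : 'M[R]_(N, m)) :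
  A *m x = 0 -> expm A *m x = x.
Proof.
move=> Ax0; apply/matrixP => i j.
have c1 : \sum_l series (expm_coeff A i l) n * x l j @[n --> \oo] --> (expm A *m x) i j.
  rewrite mxE; apply: cvg_big => [| l _]; first exact: add_continuous.
  by apply: cvgMl; exact: cvg_expm.
have c2 : \sum_l series (expm_coeff A i l) n * x l j @[n --> \oo] --> x i j.
  (* The empty partial sum gives 0, not [x]; the sequence is constant only from index 1 on. *)
  rewrite -(cvg_shiftS (fun n => \sum_l series (expm_coeff A i l) n * x l j)).
  rewrite (_ : (fun n => _) = cst (x i j)); first exact: cvg_cst.
  apply/funext => n /=.
  have -> : x i j = ((\sum_(0 <= k < n.+1) k`!%:R^-1 *: A ^+ k) *m x) i j.
    rewrite mulmx_suml big_nat_recl //= big1 ?addr0 => [|k _].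
      by rewrite invr1 scale1r expr0 mul1mx.
    by rewrite -scalemxAl exprSr -[_ * A]/(_ *m A) -mulmxA Ax0 mulmx0 scaler0.
  rewrite mxE; apply: eq_bigr => l _; congr (_ * _).
  by rewrite summxE; apply: eq_bigr => k _; rewrite mxE.
exact: (cvg_unique _ c1 c2).
Qed.

Lemma exprmx_tr {R : realType} {N : nat} (A : 'M[R]_N) k : A^T ^+ k = (A ^+ k)^T.
Proof.
elim: k => [|k IH]; first by rewrite !expr0 trmx1.
by rewrite exprS exprSr IH -[LHS]/(_ *m _) -trmx_mul.
Qed.

Lemma expm_tr {R : realType} {N : nat} (A : 'M[R]_N) : expm A^T = (expm A)^T.
Proof.
apply/matrixP => i j; rewrite mxE !expmE; congr (limn (series _)).
by apply/funext => k; rewrite /expm_coeff exprmx_tr mxE.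
Qed.

Lemma expm0 {R : realType} {N : nat} : expm (0 : 'M[R]_N) = 1%:M.
Proof. by rewrite -[LHS]mulmx1 expm_mul_ker // mul0mx. Qed.

(** * Positivity and symmetric support of the exponential *)

Lemma exprmx_ge0 {R : realType} {N : nat} (A : 'M[R]_N) k i j :
  (forall i j, 0 <= A i j) -> 0 <= (A ^+ k) i j.
Proof.
move=> A0; elim: k i j => [|k IH] i j; first by rewrite expr0 mxE.
by rewrite exprS -[A * _]/(A *m _) mxE sumr_ge0 // => l _; rewrite mulr_ge0.
Qed.

Lemma psumr_gt0_exists {R : realType} {I : finType} (F : I -> R) :
  0 < \sum_i F i -> exists i, 0 < F i.
Proof.
move=> S0; apply: contrapT => /forallNP h.
move: S0; rewrite ltNge sumr_le0 // => i _; rewrite leNgt; exact/negP.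
Qed.

(** A positive entry of [A ^+ k] comes from a path of [k] positive entries, which can be reversed: a
    factor is peeled off on the left and put back on the right. *)
Lemma exprmx_gt0_sym {R : realType} {N : nat} (A : 'M[R]_N) k i j :
  (forall i j, 0 <= A i j) -> (forall i j, 0 < A i j -> 0 < A j i) ->
  0 < (A ^+ k) i j -> 0 < (A ^+ k) j i.
Proof.
move=> A0 Asym; elim: k i j => [|k IH] i j.
  by rewrite expr0 !mxE eq_sym.
rewrite {1}exprS -[A * _]/(A *m _) mxE => /psumr_gt0_exists [l].
have := A0 i l; rewrite le_eqVlt => /predU1P[<-|Ail]; first by rewrite mul0r ltxx.
rewrite pmulr_rgt0 // => Alj.
rewrite exprSr -[_ * A]/(_ *m A) mxE (bigD1 l) //=.
apply: ltr_pwDl; first by apply: mulr_gt0; [exact: IH | exact: Asym].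
by apply: sumr_ge0 => m _; apply: mulr_ge0 => //; exact: exprmx_ge0.
Qed.

Lemma expm_coeff_ge0 {R : realType} {N : nat} (A : 'M[R]_N) i j k :
  (forall i j, 0 <= A i j) -> 0 <= expm_coeff A i j k.
Proof. by move=> A0; rewrite mulr_ge0 ?invr_ge0 ?exprmx_ge0. Qed.

(** The partial sums are nondecreasing, so a single positive term makes the entry of the exponential
    positive. *)
Lemma expm_coeff_le {R : realType} {N : nat} (A : 'M[R]_N) i j k :
  (forall i j, 0 <= A i j) -> expm_coeff A i j k <= expm A i j.
Proof.
move=> A0; have c0 l := @expm_coeff_ge0 R N A i j l A0.
rewrite expmE; apply: (@le_trans _ _ (series (expm_coeff A i j) k.+1)).
  by rewrite /series /= big_nat_recr //= lerDr sumr_ge0.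
apply: nondecreasing_cvgn_le (is_cvg_expm A i j) _.
by apply: nondecreasing_series => n _ _.
Qed.

Lemma expm_ge0 {R : realType} {N : nat} (A : 'M[R]_N) i j :
  (forall i j, 0 <= A i j) -> 0 <= expm A i j.
Proof.
by move=> A0; apply: le_trans (@expm_coeff_le R N A i j 0 A0); exact: expm_coeff_ge0.
Qed.

Lemma expm_gt0_sym {R : realType} {N : nat} (A : 'M[R]_N) i j :
  (forall i j, 0 <= A i j) -> (forall i j, 0 < A i j -> 0 < A j i) ->
  0 < expm A i j -> 0 < expm A j i.
Proof.
move=> A0 Asym Eij.
have [k Ak] : exists k, 0 < (A ^+ k) i j.
  apply: contrapT => /forallNP h; move: Eij; rewrite expmE.
  rewrite (_ : series _ = cst 0) ?lim_cst ?ltxx //.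
  apply/funext => n; rewrite /series /= big1 // => k _.
  rewrite /expm_coeff; suff -> : (A ^+ k) i j = 0 by rewrite mulr0.
  by apply/eqP; rewrite eq_le exprmx_ge0 // andbT leNgt; apply/negP.
apply: lt_le_trans (@expm_coeff_le R N A j i k A0).
by rewrite mulr_gt0 ?invr_gt0 ?ltr0n ?fact_gt0 // exprmx_gt0_sym.
Qed.

Lemma metzler_shift {R : realType} {N : nat} (A : 'M[R]_N) :
  (forall i j, i != j -> 0 <= A i j) ->
  exists2 x : R, 0 < x & forall i j, 0 <= (A + x%:M) i j.
Proof.
(* The sum dominates every negative diagonal entry; the [1] makes the shift itself positive. *)
move=> A0; exists (1 + \sum_i `|A i i|) => [|i j].
  by rewrite ltr_pwDl // sumr_ge0.
rewrite !mxE; have [<-|ij] := eqVneq i j; last by rewrite mulr0n addr0 A0.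
rewrite mulr1n (bigD1 i) //=.
have : 0 <= \sum_(k | k != i) `|A k k| by rewrite sumr_ge0.
have := ler_norm (- A i i); rewrite normrN; lra.
Qed.

Lemma metzler_expm_ge0 {R : realType} {N : nat} (A : 'M[R]_N) i j :
  (forall i j, i != j -> 0 <= A i j) -> 0 <= expm A i j.
Proof.
move=> A0; have [x _ Ax] := metzler_shift _ A0.
by have := @expm_ge0 R N _ i j Ax; rewrite expm_shift pmulr_rge0 // expR_gt0.
Qed.

Lemma metzler_expm_gt0_sym {R : realType} {N : nat} (A : 'M[R]_N) i j :
  (forall i j, i != j -> 0 <= A i j) ->
  (forall i j, i != j -> 0 < A i j -> 0 < A j i) ->
  0 < expm A i j -> 0 < expm A j i.
Proof.
move=> A0 Asym; have [x _ Ax] := metzler_shift _ A0.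
suff Bsym : forall k l, 0 < (A + x%:M) k l -> 0 < (A + x%:M) l k.
  have := @expm_gt0_sym R N _ i j Ax Bsym.
  by rewrite 2!expm_shift !(pmulr_rgt0 _ (expR_gt0 x)).
move=> k l; rewrite !mxE [l == k]eq_sym.
by have [<-//|kl] := eqVneq k l; rewrite mulr0n !addr0; exact: Asym.
Qed.

(** * Cycles, flows and currents *)

Lemma tan_pi_div_gt0 {R : realType} (n : nat) : (2 < n)%N ->
  0 < (pi : R) / n%:R < pi / 2 /\ 0 < tan ((pi : R) / n%:R).
Proof.
move=> n2; have n0 : (0 : R) < n%:R by rewrite ltr0n; lia.
have I : 0 < (pi : R) / n%:R < pi / 2.
  by rewrite divr_gt0 ?pi_gt0 //= ltr_pM2l ?pi_gt0 // ltf_pV2 ?posrE // ltr_nat.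
split=> //; rewrite /tan divr_gt0 ?sin_gt0_pihalf ?cos_gt0_pihalf //.
by case/andP: I => h ->; rewrite andbT (lt_trans _ h) // oppr_lt0 divr_gt0 ?pi_gt0.
Qed.

(** True at [x = 0] too, where both sides are 0 because [0^-1 = 0]. *)
Lemma cot_atan {R : realType} (x : R) : cot (atan x) = x^-1.
Proof. by rewrite -[in RHS](atanK x) /tan invf_div. Qed.

(** This is [polygon_cot_le] at the angles [f i], for which [cot (f i) = (C * t i)^-1]; the
    prefactor of the right side is [C^-1]. *)
Lemma polygon_tanh_le {R : realType} (F a b : nat -> R) (n : nat) :
  (2 < n)%N -> (forall i, (i < n)%N -> 0 < F i) -> a n = a 0 -> b n = b 0 ->
  2 * \sum_(0 <= i < n) (a i * b i.+1 - a i.+1 * b i) <=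
  tanh ((\sum_(0 <= i < n) F i) / (2 * n%:R)) / tan (pi / n%:R) *
  \sum_(0 <= i < n) (tanh (F i / 2))^-1 * ((a i.+1 - a i) ^+ 2 + (b i.+1 - b i) ^+ 2).
Proof.
move=> n2 F0 an bn; have [piI tn0] := @tan_pi_div_gt0 R n n2.
have n0 : (0 : R) < n%:R by rewrite ltr0n; lia.
set S := \sum_(0 <= i < n) F i; set x := S / (2 * n%:R).
have S0 : 0 < S.
  rewrite /S big_ltn; last by lia.
  rewrite ltr_pwDl ?F0 //; first by lia.
  by rewrite big_nat sumr_ge0 // => i /andP[_ lin]; rewrite ltW // F0.
have x0 : 0 < x by rewrite divr_gt0 // mulr_gt0.
have t0 := tanh_gt0 _ x0.
set u := tan (pi / n%:R) in tn0 *.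
(* Chosen so that equal forces [F i] would give [f i = pi / n] for every [i]. *)
pose C := u / tanh x.
have C0 : 0 < C by rewrite divr_gt0.
pose t i := tanh (F i / 2).
have ti0 i : (i < n)%N -> 0 < t i by move=> ?; rewrite tanh_gt0 // divr_gt0 // F0.
pose f i := atan (C * t i).
have f0 i : (i < n)%N -> 0 < f i.
  by move=> ?; rewrite -atan0 lt_atan // mulr_gt0 // ti0.
have sum_const (c : R) : \sum_(0 <= i < n) c = n%:R * c.
  by rewrite sumr_const_nat subn0 mulr_natl.
(* Jensen's inequality through the tangent of [tanh] at [x], the mean of the [F i / 2]: the linear
   terms sum to 0. *)
have sum_t : \sum_(0 <= i < n) t i <= n%:R * tanh x.
  apply: (@le_trans _ _ (\sum_(0 <= i < n)
    (tanh x + (1 - tanh x ^+ 2) * (F i / 2 - x)))).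
    rewrite big_nat [leRHS]big_nat; apply: ler_sum => i /andP[_ lin].
    by apply: tanh_tangent_le; rewrite ltW // divr_gt0 // F0.
  rewrite big_split /= sum_const -mulr_sumr sumrB sum_const -mulr_suml -/S.
  by rewrite (_ : S / 2 - n%:R * x = 0) ?mulr0 ?addr0 // /x; field; rewrite gt_eqF.
(* The tangents of [atan] at [u] sum to [pi] plus a positive multiple of [C * \sum t i - n * u],
   which [sum_t] makes nonpositive. *)
have sum_f : \sum_(0 <= i < n) f i <= pi.
  apply: (@le_trans _ _ (\sum_(0 <= i < n)
    (pi / n%:R + (1 + u ^+ 2)^-1 * (C * t i - u)))).
    rewrite big_nat [leRHS]big_nat; apply: ler_sum => i /andP[_ lin].
    have <- : atan u = pi / n%:R.
      rewrite tanK // in_itv /=; case/andP: piI => h ->.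
      by rewrite andbT; have := pi_gt0 R; lra.
    by apply: atan_tangent_le; rewrite ltW // mulr_gt0 // ti0.
  rewrite big_split /= sum_const -mulr_sumr sumrB sum_const -mulr_sumr.
  rewrite [n%:R * (_ / _)]mulrC divfK ?gt_eqF // gerDl pmulr_rle0; last first.
    by rewrite invr_gt0 ltr_pwDl // sqr_ge0.
  rewrite subr_le0 /C -mulrA [n%:R * u]mulrC ler_pM2l //.
  by rewrite ler_pdivrMl // mulrC.
have n1 : (1 < n)%N := ltnW n2.
have := @polygon_cot_le R f a b n n1 f0 sum_f an bn.
congr (_ <= _); rewrite mulr_sumr; apply: eq_bigr => i _.
by rewrite cot_atan invfM /C invf_div mulrA.
Qed.

(** * Sums and maxima over cycles *)

Section CycleSums.
Variables (N : nat).
Implicit Type c : seq 'I_N.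

(** With the head of [c] as default value, index [size c] wraps around to the first vertex, so the
    cycle is read as a closed sequence. *)
Lemma next_nth_head c x0 i : uniq c -> (i < size c)%N ->
  next c (nth (head x0 c) c i) = nth (head x0 c) c i.+1.
Proof. by case: c => // y s uc li; rewrite next_nth mem_nth // index_uniq. Qed.

Lemma nth_head_size c x0 : nth (head x0 c) c (size c) = nth (head x0 c) c 0.
Proof. by rewrite nth_default // nth0; case: c. Qed.

Lemma big_cycle_next {T : Type} {idx : T} (op : Monoid.law idx) c x0
    (G : 'I_N -> 'I_N -> T) : uniq c ->
  \big[op/idx]_(n <- c) G n (next c n) =
  \big[op/idx]_(0 <= i < size c) G (nth (head x0 c) c i) (nth (head x0 c) c i.+1).
Proof.
move=> uc; rewrite (big_nth (head x0 c)); apply: eq_big_nat => i /andP[_ li].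
by rewrite next_nth_head.
Qed.

(** [next] permutes the vertices of a cycle; on indices it is a cyclic shift. *)
Lemma big_next {T : Type} {idx : T} (op : Monoid.com_law idx) c (f : 'I_N -> T) :
  uniq c -> \big[op/idx]_(n <- c) f (next c n) = \big[op/idx]_(n <- c) f n.
Proof.
case: c => [|x0 s] uc; first by rewrite !big_nil.
rewrite (@big_cycle_next _ _ op _ x0 (fun _ m => f m) uc).
rewrite (@big_cycle_next _ _ op _ x0 (fun n _ => f n) uc).
have := @nth_head_size (x0 :: s) x0; move=> /= E.
by rewrite big_nat_recr //= big_nat_recl //= E Monoid.mulmC.
Qed.

End CycleSums.

Lemma ln_prod {R : realType} {I : eqType} (r : seq I) (F : I -> R) :
  (forall i, i \in r -> 0 < F i) -> ln (\prod_(i <- r) F i) = \sum_(i <- r) ln (F i).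
Proof.
move=> F0; rewrite -[RHS]expRK expR_sum; congr ln.
by apply: eq_big_seq => i ir; rewrite lnK // posrE F0.
Qed.

Lemma le_max_over {R : realType} {T : eqType} (K : seq T) (f : T -> R) c :
  c \in K -> f c <= max_over K f.
Proof.
case: K => [//|c0 K]; rewrite inE /= => /predU1P[->|cK].
  by apply: bigmax_ge_id.
exact: le_bigmax_seq.
Qed.

Lemma max_over_le {R : realType} {T : eqType} (K : seq T) (f g : T -> R) :
  (forall c, c \in K -> f c <= g c) -> max_over K f <= max_over K g.
Proof.
case: K => [//|c0 K] fg; rewrite [leLHS]/=.
rewrite big_seq; apply: bigmax_le => [|c cK].
  by rewrite (le_trans (fg _ (mem_head _ _))) // (le_max_over _ _ _ (mem_head _ _)).
have cK' : c \in c0 :: K by rewrite inE cK orbT.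
by rewrite (le_trans (fg _ cK')) // (le_max_over _ _ _ cK').
Qed.

(** Symmetrisation: it lets two double sums be compared on one pair [m], [n] at a time. *)
Lemma sum_pairC {R : realType} {I : finType} (h : I -> I -> R) :
  \sum_m \sum_n (h m n + h n m) = 2 * \sum_m \sum_n h m n.
Proof.
transitivity (\sum_m \sum_n h m n + \sum_m \sum_n h n m).
  by rewrite -big_split; apply: eq_bigr => m _; rewrite big_split.
by rewrite [X in _ + X]exchange_big /=; ring.
Qed.

(** Each positive current is expanded over the cycles through its edge and the sums are exchanged. A
    vertex [n] of [c] has one outgoing edge, to [next c n], and edges without positive current lie
    on no cycle of [K]. *)
Lemma sum_cycle_decomposition {R : realType} {N : nat} (J : 'I_N -> 'I_N -> R)
    (K : seq (seq 'I_N)) (Jc : seq 'I_N -> R) (g : 'I_N -> 'I_N -> R) :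
  uniform_cycle_decomposition J K Jc ->
  \sum_m \sum_n (if 0 < J m n then J m n * g n m else 0) =
  \sum_(c <- K) Jc c * \sum_(n <- c) g n (next c n).
Proof.
move=> hK.
transitivity (\sum_(n : 'I_N) \sum_(m : 'I_N) \sum_(c <- K)
   (if cycle_edge c n m then Jc c * g n m else 0)).
  rewrite exchange_big /=; apply: eq_bigr => n _; apply: eq_bigr => m _.
  case: ifP => [Jmn|Jmn].
    rewrite (ucd_sum hK Jmn) big_distrl /= big_mkcond /=.
    by apply: eq_bigr => c _; case: ifP.
  rewrite big_seq big1 // => c cK; case: ifP => // /(ucd_uniform hK cK).
  by rewrite Jmn.
transitivity (\sum_(n : 'I_N) \sum_(c <- K) \sum_(m : 'I_N)
   (if cycle_edge c n m then Jc c * g n m else 0)).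
  by apply: eq_bigr => n _; rewrite exchange_big.
rewrite exchange_big /= !big_seq; apply: eq_bigr => c cK.
have /andP[uc _] := ucd_cycle hK cK.
rewrite (big_uniq _ uc) /= mulr_sumr [RHS]big_mkcond /=.
apply: eq_bigr => n _; rewrite /cycle_edge; case: (n \in c) => /=.
  by rewrite -big_mkcond big_pred1_eq.
by rewrite big1.
Qed.

(** * Stationary flows, correlations and edge forces *)

(** In the steady state, the joint probability of [n] at time 0 and [m] at time [tau]. *)
Definition flow {R : realType} {N : nat} (W : 'M[R]_N) (p : 'cV[R]_N) (tau : R)
  (m n : 'I_N) : R := trans_prob W tau m n * p n 0.

Section Process.
Context {R : realType} {N : nat} (W : 'M[R]_N) (p : 'cV[R]_N) (tau : R).
Hypotheses (hW : jump_process W) (hp : steady_state W p) (htau : 0 < tau).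

Let P := trans_prob W tau.
Let Fl := flow W p tau.
Let J := current W p tau.

Lemma trans_prob_ge0 m n : 0 <= P m n.
Proof.
apply: metzler_expm_ge0 => i j ij.
by rewrite mxE mulr_ge0 ?(ltW htau) // (jp_rate_ge0 hW).
Qed.

Lemma trans_prob_gt0_sym m n : 0 < P m n -> 0 < P n m.
Proof.
apply: metzler_expm_gt0_sym => i j ij; rewrite mxE.
  by rewrite mulr_ge0 ?(ltW htau) // (jp_rate_ge0 hW).
by rewrite mxE !pmulr_rgt0 // => /(jp_detailed_balance hW ij).
Qed.

Lemma trans_prob_sum1 n : \sum_m P m n = 1.
Proof.
have col0 : (tau *: W)^T *m const_mx 1 = 0 :> 'cV_N.
  apply/matrixP => j k; rewrite !mxE.
  transitivity (tau * \sum_m W m j).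
    by rewrite mulr_sumr; apply: eq_bigr => m _; rewrite !mxE mulr1.
  by rewrite (bigD1 j) //= (jp_diag hW) addNr mulr0.
have := expm_mul_ker _ _ col0.
move=> /matrixP/(_ n 0); rewrite expm_tr !mxE => E; rewrite -[RHS]E.
by apply: eq_bigr => m _; rewrite !mxE mulr1.
Qed.

Lemma trans_prob_stationary m : \sum_n P m n * p n 0 = p m 0.
Proof.
have : (tau *: W) *m p = 0 by rewrite -scalemxAl (ss_stationary hp) scaler0.
by move=> /expm_mul_ker/matrixP/(_ m 0); rewrite !mxE.
Qed.

Lemma flow_ge0 m n : 0 <= Fl m n.
Proof. by rewrite mulr_ge0 ?trans_prob_ge0 // (ss_ge0 hp). Qed.

Lemma sum_flow_from n : \sum_m Fl m n = p n 0.
Proof. by rewrite -mulr_suml trans_prob_sum1 mul1r. Qed.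

Lemma sum_flow_to m : \sum_n Fl m n = p m 0.
Proof. exact: trans_prob_stationary. Qed.

Lemma corrE (b a : 'cV[R]_N) t :
  corr W p b a t = \sum_m \sum_n b m 0 * flow W p t m n * a n 0.
Proof.
rewrite /corr mxE exchange_big /=; apply: eq_bigr => n _.
rewrite mul_mx_diag !mxE !mulr_suml; apply: eq_bigr => m _.
by rewrite !mxE /flow /trans_prob; ring.
Qed.

Lemma corr0E (b a : 'cV[R]_N) : corr W p b a 0 = \sum_m b m 0 * p m 0 * a m 0.
Proof.
rewrite corrE; apply: eq_bigr => m _.
rewrite (bigD1 m) //= big1 ?addr0 => [|n nm].
  by rewrite /flow /trans_prob scale0r expm0 mxE eqxx mul1r.
by rewrite /flow /trans_prob scale0r expm0 mxE eq_sym (negPf nm) mul0r mulr0 mul0r.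
Qed.

(** Both marginals of the flow are [p], so expanding the square gives twice the equal-time
    correlation minus twice the delayed one. *)
Lemma corr_decayE (a : 'cV[R]_N) :
  2 * corr_decay W p a tau = \sum_m \sum_n Fl m n * (a m 0 - a n 0) ^+ 2.
Proof.
rewrite /corr_decay corr0E corrE.
transitivity (\sum_m \sum_n Fl m n * a m 0 ^+ 2 + \sum_m \sum_n Fl m n * a n 0 ^+ 2
   - 2 * \sum_m \sum_n a m 0 * Fl m n * a n 0); last first.
  rewrite mulr_sumr -sumrN -!big_split /=; apply: eq_bigr => m _.
  by rewrite mulr_sumr -sumrN -!big_split /=; apply: eq_bigr => n _; ring.
rewrite [X in _ + X - _]exchange_big /=.
have E1 : \sum_m \sum_n Fl m n * a m 0 ^+ 2 = \sum_m a m 0 * p m 0 * a m 0.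
  by apply: eq_bigr => m _; rewrite -mulr_suml sum_flow_to; ring.
have E2 : \sum_n \sum_m Fl m n * a n 0 ^+ 2 = \sum_m a m 0 * p m 0 * a m 0.
  by apply: eq_bigr => n _; rewrite -mulr_suml sum_flow_from; ring.
rewrite E1 E2 /Fl; ring.
Qed.

Lemma corr_decay_ge0 (a : 'cV[R]_N) : 0 <= corr_decay W p a tau.
Proof.
rewrite -(pmulr_rge0 _ (ltr0Sn R 1)) corr_decayE.
rewrite sumr_ge0 // => m _; rewrite sumr_ge0 // => n _.
by rewrite mulr_ge0 ?flow_ge0 ?sqr_ge0.
Qed.

Lemma currentE m n : J m n = Fl m n - Fl n m.
Proof. by []. Qed.

Lemma current_gt0_flow m n : 0 < J m n -> 0 < Fl m n.
Proof. by rewrite currentE subr_gt0; exact: le_lt_trans (flow_ge0 _ _). Qed.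

Lemma current_gt0_from m n : 0 < J m n -> 0 < p n 0.
Proof.
move=> /current_gt0_flow; rewrite /Fl /flow.
have := ss_ge0 hp n; rewrite le_eqVlt => /predU1P[<-|//].
by rewrite mulr0 ltxx.
Qed.

Lemma current_gt0_prob m n : 0 < J m n -> 0 < P m n.
Proof.
move=> Jmn; have := current_gt0_flow _ _ Jmn.
by rewrite /Fl /flow pmulr_lgt0 // (current_gt0_from _ _ Jmn).
Qed.

(** The current is antisymmetric, so after symmetrisation each pair counts in its direction of
    positive current. *)
Lemma corr_asymE (a b : 'cV[R]_N) :
  corr_asym W p b a tau = \sum_m \sum_n
    (if 0 < J m n then J m n * (a n 0 * b m 0 - a m 0 * b n 0) else 0).
Proof.
have -> : corr_asym W p b a tau = \sum_m \sum_n b m 0 * J m n * a n 0.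
  rewrite /corr_asym !corrE [X in _ - X]exchange_big /= -sumrB.
  apply: eq_bigr => m _; rewrite -sumrB; apply: eq_bigr => n _.
  by rewrite currentE /Fl; ring.
apply: (@mulfI _ 2%:R) => //; rewrite -!sum_pairC.
apply: eq_bigr => m _; apply: eq_bigr => n _.
have -> : J n m = - J m n by rewrite !currentE opprB.
rewrite oppr_gt0; case: (ltgtP 0 (J m n)) => [_|_|<-]; ring.
Qed.

(** Once both orientations of a pair are grouped, the left side only omits nonnegative terms with
    zero current. *)
Lemma sum_current_decay_le (a : 'cV[R]_N) :
  \sum_m \sum_n (if 0 < J m n then (Fl m n + Fl n m) * (a m 0 - a n 0) ^+ 2 else 0)
  <= 2 * corr_decay W p a tau.
Proof.
rewrite -(ler_pM2l (ltr0Sn R 1)) corr_decayE -!sum_pairC.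
apply: ler_sum => m _; apply: ler_sum => n _.
have -> : J n m = - J m n by rewrite !currentE opprB.
have F0 : 0 <= (Fl m n + Fl n m) * (a m 0 - a n 0) ^+ 2.
  by rewrite mulr_ge0 ?sqr_ge0 // addr_ge0 ?flow_ge0.
have E : Fl m n * (a m 0 - a n 0) ^+ 2 + Fl n m * (a n 0 - a m 0) ^+ 2 =
   (Fl m n + Fl n m) * (a m 0 - a n 0) ^+ 2 by ring.
have E' : (Fl n m + Fl m n) * (a n 0 - a m 0) ^+ 2 =
   (Fl m n + Fl n m) * (a m 0 - a n 0) ^+ 2 by ring.
rewrite E E' oppr_gt0; case: (ltgtP 0 (J m n)) => _; lra.
Qed.

(** Built on flows rather than transition probabilities, so that a positive current gives a positive
    force. *)
Definition edge_force (m n : 'I_N) : R := ln (Fl m n / Fl n m).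

(** The transition probabilities have symmetric support, and [p m > 0] because [p m] is the total
    flow into [m], which includes [Fl m n]. *)
Lemma current_gt0_flow_rev m n : 0 < J m n -> 0 < Fl n m.
Proof.
move=> Jmn; apply: mulr_gt0.
  by apply: trans_prob_gt0_sym; exact: current_gt0_prob.
rewrite -sum_flow_to (bigD1 n) //= ltr_pwDl ?current_gt0_flow ?sumr_ge0 // => k _.
exact: flow_ge0.
Qed.

Lemma edge_force_gt0 m n : 0 < J m n -> 0 < edge_force m n.
Proof.
move=> Jmn; have Fnm := current_gt0_flow_rev _ _ Jmn.
by rewrite ln_gt0 // ltr_pdivlMr // mul1r -subr_gt0 -currentE.
Qed.

(** Use [tanh (ln r / 2) = (r - 1) / (r + 1)] at [r = Fl m n / Fl n m]. *)
Lemma tanh_edge_force m n : 0 < J m n ->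
  (tanh (edge_force m n / 2))^-1 = (Fl m n + Fl n m) / J m n.
Proof.
move=> Jmn; have Fmn := current_gt0_flow _ _ Jmn.
have Fnm := current_gt0_flow_rev _ _ Jmn.
rewrite tanh_exp_half /edge_force lnK ?posrE ?divr_gt0 //.
have := Jmn; rewrite currentE => J0; field.
by rewrite !gt_eqF //= ?subr_gt0 ?addr_gt0 ?divr_gt0 // ltr_pdivlMr // mul1r -subr_gt0.
Qed.

(** * Affinity and area of a single cycle *)

Section Cycle.
Variables (c : seq 'I_N).
Hypotheses (cyc : is_cycle c) (Jc0 : forall n m, cycle_edge c n m -> 0 < J m n).

Lemma current_next n : n \in c -> 0 < J (next c n) n.
Proof. by move=> nc; rewrite Jc0 // /cycle_edge nc eqxx. Qed.

(** The factors [p n] in the forward and backward flows run over the same vertices, since [next]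
    permutes them, and cancel. *)
Lemma affinityE : affinity W tau c = \sum_(n <- c) edge_force (next c n) n.
Proof.
have /andP[uc _] := cyc.
rewrite -ln_prod; last first.
  move=> n /current_next Jn.
  by apply: divr_gt0; [exact: current_gt0_flow | exact: current_gt0_flow_rev].
rewrite prodf_div /affinity; congr ln; rewrite /Fl /flow !big_split /=.
rewrite (@big_next N _ _ _ c (fun n => p n 0) uc).
rewrite -mulf_div divff ?mulr1 // prodf_seq_neq0; apply/allP => n /current_next Jn.
by rewrite /= gt_eqF // (current_gt0_from _ _ Jn).
Qed.

Lemma affinity_gt0 : 0 < affinity W tau c.
Proof.
rewrite affinityE; have /andP[uc c3] := cyc.
have [n nc] : exists n, n \in c by case: (c) c3 => // n s _; exists n; rewrite mem_head.
rewrite (big_rem n nc) /= ltr_pwDl ?edge_force_gt0 ?current_next //.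
rewrite big_seq sumr_ge0 // => m /mem_rem mc.
by rewrite ltW // edge_force_gt0 ?current_next.
Qed.

(** Apply [polygon_tanh_le] to the polygon with vertices [(a n, b n)] and to the edge forces, whose
    sum is the affinity. *)
Lemma cycle_area_le (a b : 'cV[R]_N) :
  2 * \sum_(n <- c) (a n 0 * b (next c n) 0 - a (next c n) 0 * b n 0) <=
  tanh (affinity W tau c / (2 * (size c)%:R)) / tan (pi / (size c)%:R) *
  \sum_(n <- c) (Fl (next c n) n + Fl n (next c n)) / J (next c n) n *
    ((a (next c n) 0 - a n 0) ^+ 2 + (b (next c n) 0 - b n 0) ^+ 2).
Proof.
have /andP[uc c3] := cyc.
have [x0 _] : exists x0, x0 \in c.
  by case: (c) c3 => // x s _; exists x; rewrite mem_head.
rewrite affinityE.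
rewrite (@big_cycle_next N _ _ _ c x0 (fun n m => a n 0 * b m 0 - a m 0 * b n 0) uc).
rewrite (@big_cycle_next N _ _ _ c x0 (fun n m => edge_force m n) uc).
rewrite (@big_cycle_next N _ _ _ c x0 (fun n m => (Fl m n + Fl n m) / J m n *
  ((a m 0 - a n 0) ^+ 2 + (b m 0 - b n 0) ^+ 2)) uc).
set z := nth (head x0 c) c.
have Jz i : (i < size c)%N -> 0 < J (z i.+1) (z i).
  by move=> li; rewrite /z -next_nth_head // current_next // mem_nth.
have F0 i : (i < size c)%N -> 0 < edge_force (z i.+1) (z i).
  by move=> /Jz; exact: edge_force_gt0.
have zn : z (size c) = z 0 by exact: nth_head_size.
have := @polygon_tanh_le R (fun i => edge_force (z i.+1) (z i)) (fun i => a (z i) 0)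
  (fun i => b (z i) 0) (size c) c3 F0
  (congr1 (fun n => a n 0) zn) (congr1 (fun n => b n 0) zn).
congr (_ <= _ * _); apply: eq_big_nat => i /andP[_ /Jz Ji].
by rewrite tanh_edge_force.
Qed.

End Cycle.
End Process.


(** * From single cycles to the correlation bound *)

Lemma corrZ {R : realType} {N : nat} (W : 'M[R]_N) (p : 'cV[R]_N) (tau : R)
    (a b : 'cV[R]_N) (s t : R) :
  corr W p (t *: b) (s *: a) tau = t * s * corr W p b a tau.
Proof.
by rewrite /corr -scalemxAr linearZ /= -!scalemxAl !mxE; ring.
Qed.

Section Bound.
Context {R : realType} {N : nat} (W : 'M[R]_N) (p : 'cV[R]_N) (tau : R).
Hypotheses (hW : jump_process W) (hp : steady_state W p) (htau : 0 < tau).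
Variables (K : seq (seq 'I_N)) (Jc : seq 'I_N -> R).
Hypothesis hK : uniform_cycle_decomposition (current W p tau) K Jc.

Let M := max_over K (fun c =>
  tanh (affinity W tau c / (2 * (size c)%:R)) / tan (pi / (size c)%:R)).

Lemma decomposition_affinity_gt0 c : c \in K -> 0 < affinity W tau c.
Proof.
move=> cK; apply: (affinity_gt0 _ _ _ hW hp htau c (ucd_cycle hK cK)).
by move=> n m; exact: (ucd_uniform hK cK).
Qed.

Lemma cycle_ratio_ge0 c : c \in K ->
  0 <= tanh (affinity W tau c / (2 * (size c)%:R)) / tan (pi / (size c)%:R).
Proof.
move=> cK; have /andP[_ c3] := ucd_cycle hK cK.
have [_ t0] := @tan_pi_div_gt0 R _ c3.
rewrite divr_ge0 ?(ltW t0) // tanh_ge0 // divr_ge0 ?mulr_ge0 //.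
by rewrite ltW // decomposition_affinity_gt0.
Qed.

Lemma max_cycle_ratio_ge0 : 0 <= M.
Proof.
rewrite /M; case EK : K => [|c K'] //.
have cK : c \in K by rewrite EK mem_head.
by rewrite -EK (le_trans (cycle_ratio_ge0 _ cK)) // (le_max_over _ _ _ cK).
Qed.

Lemma corr_asym_le_add (a b : 'cV[R]_N) :
  corr_asym W p b a tau <= M * (corr_decay W p a tau + corr_decay W p b tau).
Proof.
pose J := current W p tau.
pose Fl := flow W p tau.
(* The division by [J] cancels the current that [sum_cycle_decomposition] restores, leaving the sums
   that [sum_current_decay_le] bounds. *)
pose h n m := (Fl m n + Fl n m) / J m n *
  ((a m 0 - a n 0) ^+ 2 + (b m 0 - b n 0) ^+ 2).
rewrite corr_asymE (sum_cycle_decomposition _ _ _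
  (fun n m => a n 0 * b m 0 - a m 0 * b n 0) hK).
apply: (@le_trans _ _ (M / 2 * \sum_(c <- K) Jc c * \sum_(n <- c) h n (next c n))).
  rewrite mulr_sumr big_seq [leRHS]big_seq; apply: ler_sum => c cK.
  rewrite mulrCA ler_pM2l ?(ucd_weight_gt0 hK cK) //.
  rewrite mulrAC ler_pdivlMr // mulrC.
  apply: le_trans (cycle_area_le _ _ _ hW hp htau _ (ucd_cycle hK cK)
    (ucd_uniform hK cK) a b) _.
  rewrite ler_wpM2r ?(le_max_over _ _ _ cK) // big_seq sumr_ge0 // => n nc.
  have Jn : 0 < J (next c n) n.
    by apply: (ucd_uniform hK cK); rewrite /cycle_edge nc eqxx.
  apply: mulr_ge0; last by rewrite addr_ge0 ?sqr_ge0.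
  by rewrite (divr_ge0 _ (ltW Jn)) // addr_ge0 ?flow_ge0.
rewrite -(sum_cycle_decomposition _ _ _ h hK) -mulrA ler_wpM2l ?max_cycle_ratio_ge0 //.
rewrite mulrC ler_pdivrMr // mulrC mulrDr.
apply: le_trans (lerD (sum_current_decay_le _ _ _ hW hp htau a)
  (sum_current_decay_le _ _ _ hW hp htau b)).
rewrite -big_split; apply: ler_sum => m _ /=.
rewrite -big_split; apply: ler_sum => n _ /=.
case: ifP => [Jmn|_]; last by rewrite addr0.
rewrite -mulrDr /h mulrA -/J mulrCA mulfV ?mulr1 //.
by rewrite gt_eqF.
Qed.

(* Rescaling [a] to [s *: a] and [b] to [s^-1 *: b] fixes the asymmetry and
   turns the sum of decays into twice their geometric mean for the best [s]. *)
Lemma corr_asym_le_sqrt (a b : 'cV[R]_N) :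
  0 < corr_decay W p a tau -> 0 < corr_decay W p b tau ->
  corr_asym W p b a tau <=
  M * (2 * Num.sqrt (corr_decay W p a tau * corr_decay W p b tau)).
Proof.
set x := corr_decay W p a tau; set y := corr_decay W p b tau => x0 y0.
(* With fourth roots, [s = v / u] makes both rescaled decays equal to [u ^+ 2 * v ^+ 2], the
   geometric mean. *)
pose u := Num.sqrt (Num.sqrt x); pose v := Num.sqrt (Num.sqrt y).
have u0 : 0 < u by rewrite !sqrtr_gt0.
have v0 : 0 < v by rewrite !sqrtr_gt0.
have u4 : u ^+ 4 = x by rewrite (exprM u 2 2) !sqr_sqrtr ?sqrtr_ge0 ?ltW.
have v4 : v ^+ 4 = y by rewrite (exprM v 2 2) !sqr_sqrtr ?sqrtr_ge0 ?ltW.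
have xy : Num.sqrt (x * y) = u ^+ 2 * v ^+ 2.
  by rewrite sqrtrM ?ltW // !sqr_sqrtr ?sqrtr_ge0.
have := corr_asym_le_add ((v / u) *: a) ((u / v) *: b).
rewrite /corr_asym /corr_decay !corrZ -!mulrBr -/x -/y xy.
rewrite [v / u * (u / v)]mulrC -!mulrBr.
rewrite (_ : u / v * (v / u) = 1) ?mul1r; last by field; rewrite !gt_eqF.
congr (_ <= _ * _).
rewrite -[corr W p a a 0 - _]/x -[corr W p b b 0 - _]/y -u4 -v4.
by field; rewrite !gt_eqF.
Qed.

End Bound.

(** Combine [tanh x <= x] at [x = F / (2 * n)] with [pi / n <= tan (pi / n)]. *)
Lemma cycle_ratio_le {R : realType} (F : R) (n : nat) : (2 < n)%N -> 0 <= F ->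
  tanh (F / (2 * n%:R)) / tan (pi / n%:R) <= F / (2 * pi).
Proof.
move=> n2 F0; have [/andP[t0 tpi] tn0] := @tan_pi_div_gt0 R n n2.
have n0 : (0 : R) < n%:R by rewrite ltr0n; lia.
have x0 : 0 <= F / (2 * n%:R) by rewrite divr_ge0 // mulr_ge0 // ltW.
rewrite ler_pdivrMr //; apply: le_trans (tanh_le_id _ x0) _.
have := @le_tan R (pi / n%:R); rewrite (ltW t0) tpi => /(_ isT) le_t.
have E (q : R) : 0 < q -> F / (2 * n%:R) = F / (2 * q) * (q / n%:R).
  by move=> q0; field; rewrite !gt_eqF.
rewrite (E _ (pi_gt0 R)).
by rewrite ler_wpM2l // divr_ge0 // mulr_ge0 // ltW // pi_gt0.
Qed.

Theorem mainTheorem4 (R : realType) (N : nat) (hN : (3 <= N)%N)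
  (W : 'M[R]_N) (hW : jump_process W)
  (p : 'cV[R]_N) (hp : steady_state W p)
  (tau : R) (htau : 0 < tau) (a b : 'cV[R]_N)
  (hD : corr_decay W p a tau * corr_decay W p b tau != 0)
  (K : seq (seq 'I_N)) (Jc : seq 'I_N -> R)
  (hK : uniform_cycle_decomposition (current W p tau) K Jc) :
  `|corr_asym W p b a tau| /
      (2 * Num.sqrt (corr_decay W p a tau * corr_decay W p b tau))
    <= max_over K (fun c =>
         tanh (affinity W tau c / (2 * (size c)%:R)) / tan (pi / (size c)%:R))
  /\
  max_over K (fun c =>
      tanh (affinity W tau c / (2 * (size c)%:R)) / tan (pi / (size c)%:R))
    <= max_over K (fun c => affinity W tau c / (2 * pi)).
Proof.
split; last first.
  apply: max_over_le => c cK; have /andP[_ c3] := ucd_cycle hK cK.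
  apply: cycle_ratio_le => //.
  exact/ltW/(decomposition_affinity_gt0 _ _ _ hW hp htau _ _ hK).
(* Both decays are nonnegative, so a nonzero product makes each of them positive. *)
move: hD; rewrite mulf_eq0 negb_or => /andP[a0 b0].
have Da : 0 < corr_decay W p a tau by rewrite lt0r a0 corr_decay_ge0.
have Db : 0 < corr_decay W p b tau by rewrite lt0r b0 corr_decay_ge0.
rewrite ler_pdivrMr; last by rewrite mulr_gt0 // sqrtr_gt0 mulr_gt0.
rewrite ler_norml lerNl; apply/andP; split; last first.
  exact: (corr_asym_le_sqrt _ _ _ hW hp htau _ _ hK).
(* Replacing [a] by [- a] flips the sign of the asymmetry and keeps the decay, which settles the
   other half of the absolute value. *)
have decayN : corr_decay W p (- a) tau = corr_decay W p a tau.
  by rewrite /corr_decay -scaleN1r !corrZ mulrNN mulr1 !mul1r.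
have <- : corr_asym W p b (- a) tau = - corr_asym W p b a tau.
  rewrite /corr_asym -scaleN1r -[b]scale1r !corrZ mulr1 mul1r scale1r; ring.
rewrite -decayN.
by apply: (corr_asym_le_sqrt _ _ _ hW hp htau _ _ hK); rewrite ?decayN.
Qed.
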